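(* Let $R=\mathbb{F}_1\times\cdots\times\mathbb{F}_n$, where every $\mathbb{F}_i$ is a field and $n\geq 2$. Then $\mathcal{EG}(R)$ is Class $1$.
   Context: All rings are commutative with identity. $A(R)$ is the set of ideals of $R$ with non-zero annihilator, and $A(R)^*=A(R)\setminus\{(0)\}$. A non-zero ideal $I$ of $R$ is essential, written $I\leq_e R$, if it has non-zero intersection with every non-zero ideal of $R$. The essential annihilating-ideal graph $\mathcal{EG}(R)$ is the simple graph with vertex set $A(R)^*$ in which two distinct vertices $I,J$ are adjacent if and only if $\mathrm{Ann}(IJ)\leq_e R$. For a graph $G$, $\Delta(G)$ is the maximum degree and $\chi'(G)$ the edge chromatic number (smallest number of colors in an edge coloring in which adjacent edges get different colors). $G$ is Class $1$ if $\chi'(G)=\Delta(G)$. *)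

(* Defs.v *)
From HB Require Import structures.
From mathcomp Require Import all_boot all_order all_algebra.
From mathcomp Require Import boolp classical_sets functions cardinality.

Set Implicit Arguments.
Unset Strict Implicit.
Unset Printing Implicit Defensive.

Import GRing.Theory.
Local Open Scope ring_scope.
Local Open Scope classical_set_scope.
Local Open Scope card_scope.

(* MathComp puts ring structures on {ffun I -> R} only for a constant codomain;
   [prod_ring A] is the direct product of a finite family of rings that may
   differ from one index to another. *)
Definition prod_ring (I : finType) (A : I -> comPzRingType) : Type :=
  {dffun forall i, A i}.

Section ProdRing.
Variables (I : finType) (A : I -> comPzRingType).
Local Notation P := (prod_ring A).
Implicit Types x y z : P.

HB.instance Definition _ := Choice.copy P {dffun forall i, A i}.

Definition prod_ring0 : P := [ffun i => 0 : A i].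
Definition prod_ring1 : P := [ffun i => 1 : A i].
Definition prod_ringN x : P := [ffun i => - x i : A i].
Definition prod_ringD x y : P := [ffun i => x i + y i : A i].
Definition prod_ringM x y : P := [ffun i => x i * y i : A i].

Fact prod_ringDA : associative prod_ringD.
Proof. by move=> x y z; apply/ffunP => i; rewrite !ffunE addrA. Qed.
Fact prod_ringDC : commutative prod_ringD.
Proof. by move=> x y; apply/ffunP => i; rewrite !ffunE addrC. Qed.
Fact prod_ring0D : left_id prod_ring0 prod_ringD.
Proof. by move=> x; apply/ffunP => i; rewrite !ffunE add0r. Qed.
Fact prod_ringND : left_inverse prod_ring0 prod_ringN prod_ringD.
Proof. by move=> x; apply/ffunP => i; rewrite !ffunE addNr. Qed.
Fact prod_ringMA : associative prod_ringM.
Proof. by move=> x y z; apply/ffunP => i; rewrite !ffunE mulrA. Qed.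
Fact prod_ringMC : commutative prod_ringM.
Proof. by move=> x y; apply/ffunP => i; rewrite !ffunE mulrC. Qed.
Fact prod_ring1M : left_id prod_ring1 prod_ringM.
Proof. by move=> x; apply/ffunP => i; rewrite !ffunE mul1r. Qed.
Fact prod_ringMDl : left_distributive prod_ringM prod_ringD.
Proof. by move=> x y z; apply/ffunP => i; rewrite !ffunE mulrDl. Qed.

HB.instance Definition _ := GRing.isZmodule.Build P
  prod_ringDA prod_ringDC prod_ring0D prod_ringND.
HB.instance Definition _ := GRing.Zmodule_isComPzRing.Build P
  prod_ringMA prod_ringMC prod_ring1M prod_ringMDl.

End ProdRing.

(* MathComp's [idealr] covers only proper ideals given by boolean predicates;
   here ideals are arbitrary sets and the whole ring is an ideal. *)
Definition is_ideal (R : comPzRingType) (I : set R) : Prop :=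
  [/\ I 0, (forall x y, I x -> I y -> I (x + y))
    & (forall r x, I x -> I (r * x))].

Definition Ann (R : comPzRingType) (I : set R) : set R :=
  [set r | forall x, I x -> r * x = 0].

Definition idealM (R : comPzRingType) (I J : set R) : set R :=
  [set x | exists (m : nat) (a b : 'I_m -> R),
     (forall k, I (a k) /\ J (b k)) /\ x = \sum_(k < m) a k * b k].

Definition essential (R : comPzRingType) (I : set R) : Prop :=
  [/\ is_ideal I, I <> [set 0]
    & forall J : set R, is_ideal J -> J <> [set 0] -> I `&` J <> [set 0]].

Definition nz_annihilating_ideal (R : comPzRingType) (I : set R) : Prop :=
  [/\ is_ideal I, Ann I <> [set 0] & I <> [set 0]].

Record sgraph := SGraph {
  vertex : Type;
  adj : vertex -> vertex -> Prop;
  adj_sym : forall u v, adj u v -> adj v u;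
  adj_irrefl : forall v, ~ adj v v
}.

Definition has_degree (G : sgraph) (v : vertex G) (d : nat) : Prop :=
  [set w | adj v w] #= `I_d.

Definition is_max_degree (G : sgraph) (k : nat) : Prop :=
  (forall v : vertex G, exists2 d, has_degree v d & (d <= k)%N) /\
  (exists v : vertex G, has_degree v k).

Definition edges (G : sgraph) : set (set (vertex G)) :=
  [set e | exists u v, adj u v /\ e = [set u; v]].

Definition edge_colorable (G : sgraph) (k : nat) : Prop :=
  exists c : set (vertex G) -> nat,
    (forall e, edges e -> (c e < k)%N) /\
    (forall e f, edges e -> edges f -> e <> f -> e `&` f !=set0 ->
       c e <> c f).

Definition is_chromatic_index (G : sgraph) (k : nat) : Prop :=
  edge_colorable G k /\ (forall m, edge_colorable G m -> (k <= m)%N).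

Definition class1 (G : sgraph) : Prop :=
  exists k, is_max_degree G k /\ is_chromatic_index G k.

Section EG.
Variable R : comPzRingType.

Definition EG_vertex : Type := {I : set R | nz_annihilating_ideal I}.

Definition EG_adj (I J : EG_vertex) : Prop :=
  I <> J /\ essential (Ann (idealM (sval I) (sval J))).

Lemma idealMC (I J : set R) : idealM I J = idealM J I.
Proof.
suff sub (A B : set R) : idealM A B `<=` idealM B A.
  by apply/seteqP; split; apply: sub.
move=> x [m [a [b [ab ->]]]]; exists m, b, a; split=> [k|].
  by have [] := ab k.
by apply: eq_bigr => k _; rewrite mulrC.
Qed.

Lemma EG_adj_sym I J : EG_adj I J -> EG_adj J I.
Proof.
by move=> [neqIJ essIJ]; split; [apply: nesym | rewrite idealMC].
Qed.

Lemma EG_adj_irrefl I : ~ EG_adj I I.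
Proof. by case. Qed.

Definition EG : sgraph := SGraph EG_adj_sym EG_adj_irrefl.

End EG.

(* Main.v *)
Require Import Defs.
From mathcomp Require Import boolp classical_sets functions cardinality.
From mathcomp Require Import all_boot all_algebra.

(* An ideal of a finite product of fields is determined by its support, and
   the whole ring is the only essential ideal; so EG(R) is the graph on the
   nonempty proper subsets of the index set I, with disjointness as adjacency.
   Its maximum degree 2^(|I|-1) - 1 is reached at the singletons. Give the edge
   {A, B} the colour {U, ~U}, where U is the union of A and B, or U = A if that
   union is everything; there are 2^(|I|-1) - 1 such colours. The edges A, B
   with union U or ~U have their ends strictly inside U or ~U, so they miss
   the ends of the edge {U, ~U}, and two of them sharing an end have the same
   union; hence the colouring is proper. *)

Set Implicit Arguments.
Unset Strict Implicit.
Unset Printing Implicit Defensive.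

(** * Labels of disjoint pairs of sets, up to complement *)

Section EdgeLabel.
Variables (T : finType) (t0 : T).
Implicit Types A B C U V : {set T}.

Definition nonempty_subsets A : {set {set T}} := powerset A :\ set0.

Lemma mem_nonempty_subsets A B :
  (B \in nonempty_subsets A) = (B != set0) && (B \subset A).
Proof. by rewrite !inE. Qed.

(** Encodes the pair of [U] and its complement by the member that misses [t0]. *)
Definition complement_class U := if t0 \in U then ~: U else U.

Lemma complement_class_inj U V :
  complement_class U = complement_class V -> U = V \/ U = ~: V.
Proof.
rewrite /complement_class; case: ifP => tU; case: ifP => tV E.
- by left; apply: setC_inj.
- by right; rewrite -E setCK.
- by right.
- by left.
Qed.

Lemma complement_classC U : complement_class (~: U) = complement_class U.
Proof.
by rewrite /complement_class inE; case: (t0 \in U); rewrite //= setCK.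
Qed.

Lemma complement_class_nonempty U :
  U != set0 -> U != setT ->
  complement_class U \in nonempty_subsets (~: [set t0]).
Proof.
move=> U0 UT; rewrite mem_nonempty_subsets /complement_class.
case: ifP => tU; apply/andP; split => //.
- by apply: contra UT => /eqP UC0; rewrite -(setCK U) UC0 setC0.
- by rewrite setCS sub1set.
- by rewrite subsetC sub1set inE tU.
Qed.

Definition edge_label A B :=
  complement_class (if A :|: B == setT then A else A :|: B).

(** If the union is everything, disjointness makes [B] the complement of [A], and complements have
    the same class. *)
Lemma edge_labelC A B : [disjoint A & B] -> edge_label A B = edge_label B A.
Proof.
move=> dAB; rewrite /edge_label [B :|: A]setUC.
case: eqP => // ABT; rewrite -complement_classC; congr complement_class.
apply/setP=> x; have := congr1 (fun C : {set T} => x \in C) ABT; rewrite !inE.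
by case: (boolP (x \in A)) => //= xA _; rewrite (disjointFr dAB).
Qed.

Lemma edge_label_nonempty A B : A != set0 -> A != setT ->
  edge_label A B \in nonempty_subsets (~: [set t0]).
Proof.
move=> A0 AT; apply: complement_class_nonempty; case: ifPn => //.
by rewrite setU_eq0 negb_and A0.
Qed.

(** Properness at a shared end [A]: a point of [A] lies in both unions, so these are not
    complementary, and equal unions cancel [A] by disjointness. *)
Lemma edge_label_inj A B C : A != set0 -> B != set0 -> C != set0 ->
  [disjoint A & B] -> [disjoint A & C] ->
  edge_label A B = edge_label A C -> B = C.
Proof.
move=> /set0Pn[a aA] /set0Pn[b bB] /set0Pn[c cC] dAB dAC.
have aC : a \in C = false by rewrite (disjointFr dAC).
have aB : a \in B = false by rewrite (disjointFr dAB).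
have bA : b \in A = false by rewrite (disjointFl dAB).
have cA : c \in A = false by rewrite (disjointFl dAC).
have cancel_union : A :|: B = A :|: C -> B = C.
  move=> E; apply/setP => x.
  have := congr1 (fun D : {set T} => x \in D) E; rewrite !inE.
  by case: (boolP (x \in A)) => // xA _; rewrite !(disjointFr _ xA).
rewrite /edge_label; case: eqP => EB; case: eqP => EC.
- by move=> _; apply: cancel_union; rewrite EB EC.
(* Only one union is full: [c] shows [A] differs from [A :|: C], and [a] shows it differs from the
   complement. *)
- case/complement_class_inj => /setP E.
    by have := E c; rewrite !inE cC cA.
  by have := E a; rewrite !inE aA.
- case/complement_class_inj => /setP E.
    by have := E b; rewrite !inE bB bA.
  by have := E a; rewrite !inE aA.
- case/complement_class_inj => [//|/setP E].
  by have := E a; rewrite !inE aA.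
Qed.

End EdgeLabel.

(** * Colours forced by a degree *)

Lemma pair_eqr (V : Type) (u v w : V) :
  ([set u; v] = [set u; w])%classic -> u <> v -> v = w.
Proof.
move=> E uv; have : ([set u; w] v)%classic by rewrite -E; right.
by case=> [vu|//]; case: uv.
Qed.

(** All edges at [v] meet there, so sending a neighbour [w] to the colour of its edge to [v] is
    injective. *)
Lemma has_degree_le_colors (G : sgraph) (v : vertex G) (d m : nat) :
  has_degree v d -> edge_colorable G m -> d <= m.
Proof.
move=> dv [c [c_lt c_neq]]; rewrite -card_le_II.
have /card_eqPle[_ le_d] := dv.
apply: (card_le_trans le_d).
have c_inj : {in [set w | adj v w]%classic &,
    injective (fun w => c [set v; w]%classic)}.
  move=> w w' /set_mem vw /set_mem vw' cE.
  have [->//|ww'] := pselect (w = w').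
  case: (c_neq [set v; w] [set v; w'])%classic => //.
  - by exists v, w.
  - by exists v, w'.
  - move=> E; apply/ww'/(pair_eqr E) => vw_eq; apply: (@adj_irrefl G w).
    by rewrite -{1}vw_eq.
  - by exists v; split; left.
have /card_eqPle[_ le_im] := inj_card_eq c_inj.
apply: (card_le_trans le_im); apply: subset_card_le => _ [w vw <-] /=.
by apply: c_lt; exists v, w.
Qed.

(** * Disjointness graphs on nonempty proper subsets *)

Section DisjointnessGraph.
Variables (T : finType) (G : sgraph) (f : vertex G -> {set T}).
Hypotheses (f_inj : injective f)
  (f_neq0 : forall v, f v != set0) (f_neqT : forall v, f v != setT)
  (f_surj : forall A, A != set0 -> A != setT -> exists v, f v = A)
  (f_adj : forall u v, adj u v <-> [disjoint f u & f v]).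

Lemma disjointness_degree v : has_degree v #|nonempty_subsets (~: f v)|.
Proof.
set D := nonempty_subsets _; apply/card_set_bijP.
exists (fun w => index (f w) (enum D)).
have fD w : adj v w -> f w \in enum D.
  move/f_adj; rewrite mem_enum mem_nonempty_subsets f_neq0.
  by rewrite -disjoints_subset disjoint_sym.
split.
- by move=> w /= /fD; rewrite -index_mem -cardE.
- move=> w w' /set_mem/fD wD /set_mem/fD w'D /(index_inj set0 wD w'D).
  exact: f_inj.
- move=> k /= kD; rewrite cardE in kD.
  have := mem_nth set0 kD.
  rewrite mem_enum mem_nonempty_subsets => /andP[A0 Av].
  have [w fw] : exists w, f w = nth set0 (enum D) k.
    (* Were this subset of [~: f v] full, [f v] would be empty. *)
    apply: f_surj => //; apply: contraNneq (f_neq0 v) => AT.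
    by rewrite AT subTset in Av; rewrite -(setCK (f v)) (eqP Av) setCT.
  exists w; last by rewrite fw index_uniq ?enum_uniq.
  by apply/f_adj; rewrite disjoint_sym disjoints_subset fw.
Qed.

Lemma disjointness_colorable (t0 : T) :
  edge_colorable G #|nonempty_subsets (~: [set t0])|.
Proof.
set K := nonempty_subsets _.
pose color u v := index (edge_label t0 (f u) (f v)) (enum K).
have labelK u v : edge_label t0 (f u) (f v) \in enum K.
  by rewrite mem_enum edge_label_nonempty.
have colorC u v : adj u v -> color u v = color v u.
  by move=> /f_adj uv; rewrite /color edge_labelC.
(* An edge is an unordered set, so its ends are picked by choice; [colorC] makes their order
   irrelevant. Sets that are not edges get the dummy colour 0. *)
have [c cP] : {c : set (vertex G) -> nat & forall e, edges e ->
    exists u v, [/\ adj u v, e = [set u; v]%classic & c e = color u v]}.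
  apply: (@choice _ _ (fun e k => edges e -> exists u v,
    [/\ adj u v, e = [set u; v]%classic & k = color u v])) => e.
  have [[u [v [uv eE]]]|ne] := pselect (edges e); last by exists 0.
  by exists (color u v) => _; exists u, v.
exists c; split.
  by move=> e /cP[u [v [_ _ ->]]]; rewrite cardE index_mem.
(* Any end of an edge can serve as its first end, so two edges meeting at [w] can be compared from
   [w]. *)
have cPw e w : edges e -> e w ->
    exists v, [/\ adj w v, e = [set w; v]%classic & c e = color w v].
  move=> /cP[u [v [uv eE ce]]] ew; have : [set u; v]%classic w by rewrite -eE.
  case=> /= ->; first by exists v.
  by exists u; rewrite classical_sets.setUC -colorC //; split=> //;
    apply: adj_sym.
move=> e e' edge_e edge_e' ne [w [we we']] cE; apply: ne.
have [v [wv eE ce]] := cPw _ _ edge_e we.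
have [v' [wv' eE' ce']] := cPw _ _ edge_e' we'.
suff vv' : v = v' by rewrite eE eE' vv'.
apply: f_inj; move: cE; rewrite ce ce'.
move=> /(index_inj set0 (labelK _ _) (labelK _ _)).
by apply: edge_label_inj => //; apply/f_adj.
Qed.

(** The number of colours equals the degree of the vertex with set [[set t0]], which is maximal and
    forces that many colours. *)
Lemma disjointness_class1 : 1 < #|T| -> class1 G.
Proof.
move=> T_gt1; have /card_gt0P[t0 _] := ltnW T_gt1.
exists #|nonempty_subsets (~: [set t0])|.
have [v0 fv0] : exists v, f v = [set t0].
  apply: f_surj; first by apply/set0Pn; exists t0; rewrite inE.
  by apply: contraTneq T_gt1 => E; rewrite -cardsT -E cards1.
have deg0 : has_degree v0 #|nonempty_subsets (~: [set t0])|.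
  by rewrite -fv0; apply: disjointness_degree.
split; split.
- move=> v; exists #|nonempty_subsets (~: f v)|; first exact: disjointness_degree.
  have card_nonempty (A : {set T}) : #|nonempty_subsets A| = (2 ^ #|A|).-1.
    by rewrite -card_powerset [in RHS](cardsD1 set0) powersetE sub0set.
  (* The degree [2 ^ (#|T| - #|f v|) - 1] decreases with [#|f v|], which is at least 1. *)
  rewrite !card_nonempty -!subn1 leq_sub2r // leq_exp2l // cardsCs setCK.
  by rewrite [X in _ <= X]cardsCs setCK cards1 leq_sub2l // card_gt0.
- by exists v0.
- exact: disjointness_colorable.
- by move=> m; apply: has_degree_le_colors deg0.
Qed.

End DisjointnessGraph.

(** * Ideals of a finite product of fields *)

Section ProductOfFields.
Import GRing.Theory.
Local Open Scope ring_scope.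
Variables (I : finType) (F : I -> fieldType).
Local Notation R := (prod_ring (fun i => F i)).
Implicit Types (A : {set I}) (J K : set R) (x y : R).

Lemma prod_ringE :
  ((forall x y i, ((x * y) i = x i * y i)%R) *
   (forall x y i, ((x + y) i = x i + y i)%R) *
   (forall i, ((0 : R) i = 0)%R) * (forall i, ((1 : R) i = 1)%R))%type.
Proof. by split=> [|i]; [split=> [|i]; [split=> x y i|]|]; rewrite ffunE. Qed.

Lemma prod_ring_sumE (m : nat) (a : 'I_m -> R) i :
  (\sum_k a k) i = \sum_k a k i.
Proof.
by apply: (big_morph (fun x : R => x i)) => [x y|]; rewrite prod_ringE.
Qed.

Definition coord_idem A : R := [ffun i => (i \in A)%:R : F i].

Definition support_ideal A : set R :=
  [set x : R | forall i, i \notin A -> x i = 0]%classic.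

Definition ideal_support J : {set I} :=
  [set i | `[< exists2 x : R, J x & x i != 0 >]].

Lemma ideal_supportP J i :
  reflect (exists2 x : R, J x & x i != 0) (i \in ideal_support J).
Proof. by rewrite inE; apply: asboolP. Qed.

Lemma support_ideal_ideal A : is_ideal (support_ideal A).
Proof.
split=> [i _|x y xA yA i iA|r x xA i iA]; rewrite prod_ringE //.
  by rewrite xA // yA // addr0.
by rewrite xA // mulr0.
Qed.

Lemma coord_idemE A i : coord_idem A i = (i \in A)%:R.
Proof. by rewrite ffunE. Qed.

Lemma support_ideal_idem A : support_ideal A (coord_idem A).
Proof. by move=> i iA; rewrite coord_idemE (negbTE iA). Qed.

(** Fields enter here: the coordinate of [x] at [i] is inverted and the others are killed. *)
Lemma ideal_support_idem J i : is_ideal J -> i \in ideal_support J ->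
  J (coord_idem [set i]).
Proof.
move=> [_ _ JM] /ideal_supportP[x Jx xi].
(* Writing [x j] rather than [x i] gives the inverse the type [F j]. *)
pose r : R := [ffun j => if j == i then (x j)^-1 else 0 : F j].
suff -> : coord_idem [set i] = r * x by apply: JM.
apply/ffunP => j; rewrite coord_idemE prod_ringE ffunE !inE.
by case: eqP => [->|_]; rewrite ?mulVf ?mul0r.
Qed.

(** An [x] vanishing off the support is the sum of its coordinate parts; each is a multiple of an
    idempotent in [J], or is 0. *)
Lemma ideal_supportK J : is_ideal J -> support_ideal (ideal_support J) = J.
Proof.
move=> idJ; have [J0 JD JM] := idJ; apply/seteqP; split=> x.
  move=> xJ; suff -> : x = \sum_(k < #|I|) x * coord_idem [set enum_val k].
    apply: big_ind => // k _.
    have [kJ|kJ] := boolP (enum_val k \in ideal_support J).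
      by apply: JM; apply: ideal_support_idem.
    suff -> : x * coord_idem [set enum_val k] = 0 by [].
    apply/ffunP => i; rewrite !prod_ringE coord_idemE inE.
    by case: eqP => [->|_]; rewrite ?(xJ _ kJ) ?mul0r ?mulr0.
  apply/ffunP => i; rewrite prod_ring_sumE (bigD1 (enum_rank i)) //= big1.
    by rewrite addr0 prod_ringE coord_idemE enum_rankK inE eqxx mulr1.
  move=> k /eqP ki; rewrite prod_ringE coord_idemE inE.
  by case: eqP => [ik|_]; rewrite ?mulr0 //; case: ki; rewrite ik enum_valK.
move=> Jx i; apply: contraNeq => xi; by apply/ideal_supportP; exists x.
Qed.

Lemma support_idealK A : ideal_support (support_ideal A) = A.
Proof.
apply/setP => i; apply/ideal_supportP/idP => [[x xA]|iA].
  by apply: contraNT => /xA ->.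
exists (coord_idem A); first exact: support_ideal_idem.
by rewrite coord_idemE iA oner_neq0.
Qed.

Lemma ideal_support_eq0 J : is_ideal J ->
  (ideal_support J == set0) <-> J = [set 0]%classic.
Proof.
move=> [J0 _ _]; split=> [/eqP E|->].
  apply/seteqP; split=> [x Jx|_ ->//]; apply/ffunP => i.
  rewrite prod_ringE; apply/eqP; apply: contraT => xi.
  by have : i \in ideal_support J by [apply/ideal_supportP; exists x]; rewrite E inE.
apply/eqP/setP => i; rewrite [RHS]inE; apply/negbTE/ideal_supportP => -[x ->].
by rewrite prod_ringE eqxx.
Qed.

(** With full support, the idempotents in [J] kill each coordinate of an annihilator; otherwise the
    idempotent of the complement of the support annihilates [J]. *)
Lemma Ann_eq0 J : is_ideal J ->
  (ideal_support J == setT) <-> Ann J = [set 0]%classic.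
Proof.
move=> idJ; split=> [/eqP E|E].
  apply/seteqP; split=> [r rJ|_ -> x _]; last by rewrite mul0r.
  apply/ffunP => i.
  have iJ : i \in ideal_support J by rewrite E inE.
  have := congr1 (fun x : R => x i) (rJ _ (ideal_support_idem idJ iJ)).
  by rewrite prod_ringE coord_idemE set11 mulr1.
apply: contraT => /eqP ET; have : Ann J (coord_idem (~: ideal_support J)).
  move=> x Jx; apply/ffunP => i; rewrite !prod_ringE coord_idemE inE.
  case: (boolP (i \in _)) => iJ; rewrite ?mul0r //= mul1r.
  by move: Jx; rewrite -{1}(ideal_supportK idJ); apply.
rewrite E => /= E0; case: ET; apply/setP => i; rewrite [RHS]inE.
have := congr1 (fun x : R => x i) E0; rewrite prod_ringE coord_idemE inE.
by case: (_ \in _) => //= /eqP; rewrite oner_eq0.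
Qed.

(** A common index [i] puts its idempotent in the product, so the annihilator vanishes at [i] and
    meets [support_ideal [set i]] only in 0. Disjoint supports make the product zero and its
    annihilator the whole ring. *)
Lemma essential_Ann_idealM J K : is_ideal J -> is_ideal K ->
  ideal_support J != set0 ->
  essential (Ann (idealM J K)) <-> [disjoint ideal_support J & ideal_support K].
Proof.
move=> idJ idK /set0Pn[j jJ]; split.
  move=> [_ _ essE]; apply/pred0P => i /=; apply/negbTE/negP => /andP[iJ iK].
  pose e := coord_idem [set i].
  have JKe : idealM J K e.
    exists 1%N, (fun=> e), (fun=> e); split.
      by split; apply: ideal_support_idem.
    rewrite big_ord1; apply/ffunP => k; rewrite prod_ringE coord_idemE.
    by case: (_ \in _); rewrite ?mulr1 ?mulr0.
  case: (essE _ (support_ideal_ideal [set i])).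
    move/(ideal_support_eq0 (support_ideal_ideal _)); rewrite support_idealK.
    by move=> /eqP/setP/(_ i); rewrite !inE eqxx.
  apply/seteqP; split=> [x [Ax xi]|_ -> /=]; last first.
    split; last by move=> k _; rewrite prod_ringE.
    by move=> x _; rewrite mul0r.
  apply/ffunP => k; rewrite prod_ringE.
  have [->|ki] := eqVneq k i; last by rewrite xi // inE.
  have := congr1 (fun x : R => x i) (Ax _ JKe).
  by rewrite !prod_ringE coord_idemE set11 mulr1.
move=> dJK; suff -> : Ann (idealM J K) = classical_sets.setT.
  split=> //; last by move=> L _; rewrite classical_sets.setTI.
  (* The index [j] witnesses that the ring is nonzero. *)
  move=> E; have : [set: R]%classic (coord_idem [set j]) by [].
  rewrite E => /(congr1 (fun x : R => x j)) /eqP.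
  by rewrite coord_idemE set11 prod_ringE oner_eq0.
apply/seteqP; split=> // r _ _ [m [a [b [ab ->]]]].
rewrite big1 ?mulr0 // => k _; have [Ja Kb] := ab k.
apply/ffunP => i; rewrite !prod_ringE; apply/eqP; rewrite mulf_eq0.
apply: contraT; rewrite negb_or => /andP[ai bi].
have iJ : i \in ideal_support J by apply/ideal_supportP; exists (a k).
have iK : i \in ideal_support K by apply/ideal_supportP; exists (b k).
by rewrite (disjointFr dJK iJ) in iK.
Qed.

(** Through supports, a nonzero ideal means a nonempty set and a nonzero annihilator means a proper
    one. *)
Lemma EG_prod_fields_class1 : (1 < #|I|)%N -> class1 (EG R).
Proof.
apply: (@disjointness_class1 I (EG R) (fun v => ideal_support (sval v))).
- move=> [J [idJ J1 J2]] [K [idK K1 K2]] /= E.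
  apply: eq_exist; by rewrite -(ideal_supportK idJ) E ideal_supportK.
- by move=> [J [idJ ? ?]] /=; apply/negP => /(ideal_support_eq0 idJ).
- by move=> [J [idJ ? ?]] /=; apply/negP => /(Ann_eq0 idJ).
- move=> A A0 AT; have idA := support_ideal_ideal A.
  have vA : nz_annihilating_ideal (support_ideal A).
    split=> //; first by move/(Ann_eq0 idA); rewrite support_idealK (negbTE AT).
    by move/(ideal_support_eq0 idA); rewrite support_idealK (negbTE A0).
  by exists (exist _ _ vA); rewrite /= support_idealK.
- move=> [J [idJ J1 J2]] [K [idK K1 K2]] /=.
  have J0 : ideal_support J != set0 by apply/negP => /(ideal_support_eq0 idJ).
  rewrite /EG_adj /= -(essential_Ann_idealM idJ idK J0); split=> [[]//|ess].
  (* Distinctness comes from disjointness: a nonempty support is not disjoint from itself. *)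
  split=> // -[JK]; move: ess; rewrite JK (essential_Ann_idealM idK idK) -?JK //.
  by rewrite -setI_eq0 setIid (negbTE J0).
Qed.

End ProductOfFields.

Theorem theorem2p5 (n : nat) (hn : (2 <= n)%N) (F : 'I_n -> fieldType) :
  class1 (EG (prod_ring (fun i : 'I_n => F i))).
Proof. by apply: EG_prod_fields_class1; rewrite card_ord. Qed.
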